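(* There are absolute constants $c_1,c_2>0$ such that for every integer $n'$ there exist an integer $n\ge n'$ and a set $X$ of $n$ points that is a permutation, such that $\mathrm{WB}^{(2)}(X)\ge c_1\, n\log\log n$ but $\mathrm{WB}(X)\le c_2\, n\log\log\log n$.
   Context: Points have integer coordinates. $X$ is a permutation if every horizontal and every vertical line contains at most one point of $X$. For non-collinear points $p,q$ (differing in both coordinates), $\square_{p,q}$ is the smallest closed axis-parallel rectangle containing both. Strong (first) Wilber bound: let $B$ be the bounding box of $X$ and $\mathcal L(X)$ the vertical lines with half-integral $x$-coordinate strictly between the minimum and maximum $x$-coordinates of $X$. For an ordering $\sigma$ of $\mathcal L(X)$, process lines in order starting from $\{B\}$; each line $L$ splits the current vertical strip $S$ containing it and is charged the number of indices $j$ with $q_j,q_{j+1}$ on opposite sides of $L$, where $q_1,\dots,q_z$ are the points of $X\cap S$ in increasing $y$-order. $\mathrm{WB}_\sigma(X)$ is the total charge and $\mathrm{WB}(X)=\max_\sigma\mathrm{WB}_\sigma(X)$. Second Wilber (funnel) bound: for $p\in X$, the funnel $\mathrm{funnel}(X,p)$ is the set of points $q\in X$ with $q.y<p.y$ such that $\square_{p,q}$ contains no point of $X\setminus\{p,q\}$. Writing $\mathrm{funnel}(X,p)=\{a_1,\dots,a_r\}$ in increasing $y$-order, $\mathrm{alt}(X,p)$ is the number of indices $1\le i<r$ such that one of $a_i,a_{i+1}$ lies strictly left of $p$ and the other strictly right of $p$. Then $\mathrm{WB}^{(2)}(X)=|X|+\sum_{p\in X}\mathrm{alt}(X,p)$.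 *)

(* Defs.v *)
From Stdlib Require Import Bool ZArith List Reals.
Import ListNotations.
Open Scope Z_scope.
Open Scope bool_scope.

Definition point := (Z * Z)%type.

Definition pt_eqb (p q : point) : bool := (fst p =? fst q) && (snd p =? snd q).

Definition is_perm (X : list point) : Prop :=
  NoDup X /\
  forall p q, In p X -> In q X -> p <> q -> fst p <> fst q /\ snd p <> snd q.

Definition countb (f : point -> point -> bool) (S : list point) : nat :=
  length (filter (fun ab => f (fst ab) (snd ab)) (list_prod S S)).

Definition consec (S : list point) (a b : point) : bool :=
  (snd a <? snd b) &&
  forallb (fun r => negb ((snd a <? snd r) && (snd r <? snd b))) S.

(* A vertical line with half-integral x-coordinate k + 1/2 is represented by k.
   A point q is left of line k iff q.x <= k. *)
Definition charge (S : list point) (k : Z) : nat :=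
  countb (fun a b => consec S a b && xorb (fst a <=? k) (fst b <=? k)) S.

Fixpoint wbrec (fuel : nat) (St : list point) (sigma : list Z) : nat :=
  match fuel with
  | O => O
  | Datatypes.S f =>
    match sigma with
    | [] => O
    | k :: sigma' =>
      Nat.add (Nat.add (charge St k)
        (wbrec f (filter (fun q : point => fst q <=? k) St) (filter (fun l => l <? k) sigma')))
        (wbrec f (filter (fun q : point => k <? fst q) St) (filter (fun l => k <? l) sigma'))
    end
  end.

Definition minx (X : list point) : Z :=
  match X with [] => 0 | p :: X' => fold_left Z.min (map fst X') (fst p) end.
Definition maxx (X : list point) : Z :=
  match X with [] => 0 | p :: X' => fold_left Z.max (map fst X') (fst p) end.

(* L(X): lines x = k + 1/2 with minx < k + 1/2 < maxx, i.e. minx <= k < maxx *)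
Definition lines (X : list point) : list Z :=
  map (fun i => minx X + Z.of_nat i) (seq 0 (Z.to_nat (maxx X - minx X))).

Definition WB_sigma (X : list point) (sigma : list Z) : nat :=
  wbrec (length sigma) X sigma.

Fixpoint insert_everywhere (x : Z) (l : list Z) : list (list Z) :=
  match l with
  | [] => [[x]]
  | y :: l' => (x :: y :: l') :: map (cons y) (insert_everywhere x l')
  end.

Fixpoint perms (l : list Z) : list (list Z) :=
  match l with
  | [] => [[]]
  | x :: l' => flat_map (insert_everywhere x) (perms l')
  end.

Definition WB (X : list point) : nat :=
  fold_right Nat.max O (map (WB_sigma X) (perms (lines X))).

Definition in_box (p q r : point) : bool :=
  (Z.min (fst p) (fst q) <=? fst r) && (fst r <=? Z.max (fst p) (fst q)) &&
  (Z.min (snd p) (snd q) <=? snd r) && (snd r <=? Z.max (snd p) (snd q)).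

Definition funnel (X : list point) (p : point) : list point :=
  filter (fun q => (snd q <? snd p) &&
            forallb (fun r => pt_eqb r p || pt_eqb r q || negb (in_box p q r)) X) X.

Definition alt (X : list point) (p : point) : nat :=
  let F := funnel X p in
  countb (fun a b => consec F a b &&
            (((fst a <? fst p) && (fst p <? fst b)) ||
             ((fst b <? fst p) && (fst p <? fst a)))) F.

Definition WB2 (X : list point) : nat :=
  Nat.add (length X) (fold_right Nat.add O (map (alt X) X)).

(* Main.v *)
Require Import Defs.
From Stdlib Require Import ZArith List Reals Lia Lra Bool.
Import ListNotations.
Open Scope Z_scope.

(** The set consists of [T = 2^K] stacked copies, [K = 2^k], of a bit-reversal permutation of
    size [K], in which the [j]-th point of copy [t] has abscissa about [K (t + 2^j)].

    For the funnel bound, the funnel of a point within its own copy is that of the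
    bit-reversal permutation, and it alternates once for every set bit of the index, so
    about [k / 2] times on average.

    For the first bound, consider a strip of width [w] cut into parts, the smaller one of width
    [w1 >= K]. The scales [j] with [K 2^j >= 2 w] cross the strip one after the other, each of
    them monotonically, so they alternate [O(K)] times in total. The scale [j] with
    [K 2^j < 2 w] contributes [O(min(w1, K 2^j) / K)] alternations: either few copies meet
    the small part, or few copies have the line between their origin and their point of scale
    [j]. This is the amount that the superadditive function [w -> max(0, 4 w - K 2^j) / K]
    gains when the two parts are merged, so these functions, summed over [j], telescope along
    any ordering of the lines and give [WB X = O(|X|)]. *)

(** * Counting through relations, integer intervals and integer sums *)

(** Partners in [T] are chosen one at a time along [l], and injectivity keeps them distinct. A
    relation suits the later counts, where one alternation may fit several codes. *)
Lemma rel_inj_length {A B : Type} (Q : A -> B -> Prop) (l : list A) (T : list B) :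
  NoDup l ->
  (forall e, In e l -> exists c, In c T /\ Q e c) ->
  (forall e e' c, In e l -> In e' l -> Q e c -> Q e' c -> e = e') ->
  (length l <= length T)%nat.
Proof.
  intros Hnd Hex Hinj.
  (* The last clause traces every chosen partner back to [l], which shows that the next choice is
     new. *)
  assert (H : exists m, length m = length l /\ NoDup m /\ incl m T /\
                        forall c, In c m -> exists e, In e l /\ Q e c).
  { clear -Hnd Hex Hinj. induction Hnd as [|e l Hni Hnd IH].
    - exists []. repeat split; [constructor | intros c [] | intros c []].
    - destruct IH as (m & Hlen & Hm & Hincl & Hback).
      + intros e' He'. apply Hex. now right.
      + intros e1 e2 c H1 H2. apply Hinj; now right.
      + destruct (Hex e (or_introl eq_refl)) as (c & HcT & Hc).
        exists (c :: m). repeat split.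
        * simpl. congruence.
        * constructor; [|exact Hm]. intros Hcm.
          destruct (Hback c Hcm) as (e' & He' & Hc').
          assert (e = e') by (apply (Hinj e e' c); simpl; auto). subst. contradiction.
        * intros x [<-|Hx]; auto.
        * intros x [<-|Hx]; [exists e; simpl; auto|].
          destruct (Hback x Hx) as (e' & He' & Hc'). exists e'. simpl; auto. }
  destruct H as (m & <- & Hm & Hincl & _). now apply NoDup_incl_length.
Qed.

Lemma NoDup_list_prod {A B : Type} (l : list A) (m : list B) :
  NoDup l -> NoDup m -> NoDup (list_prod l m).
Proof.
  intros Hl Hm. induction Hl as [|x l Hx Hl IH]; simpl; [constructor|].
  apply NoDup_app; [| exact IH |].
  - apply NoDup_map_NoDup_ForallPairs; [|exact Hm]. intros a b _ _ H. congruence.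
  - intros [u v] H1 H2. apply in_map_iff in H1 as (z & Hz & _). injection Hz as <- <-.
    apply in_prod_iff in H2. tauto.
Qed.

(** Half-open as [(lo, hi]], like the strips, which a cut at [k] splits into [(a, k]] and
    [(k, b]]. *)
Definition zint (lo hi : Z) : list Z :=
  map (fun i => lo + 1 + Z.of_nat i) (seq 0 (Z.to_nat (hi - lo))).

Lemma in_zint lo hi x : In x (zint lo hi) <-> lo < x <= hi.
Proof.
  unfold zint. rewrite in_map_iff. split.
  - intros (i & <- & Hi). apply in_seq in Hi. lia.
  - intros H. exists (Z.to_nat (x - lo - 1)). rewrite in_seq. lia.
Qed.

Lemma length_zint lo hi : length (zint lo hi) = Z.to_nat (hi - lo).
Proof. unfold zint. now rewrite length_map, length_seq. Qed.

Lemma NoDup_zint lo hi : NoDup (zint lo hi).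
Proof.
  apply NoDup_map_NoDup_ForallPairs; [|apply seq_NoDup]. intros i j _ _ H. lia.
Qed.

Definition zsum {A : Type} (f : A -> Z) (l : list A) : Z := fold_right Z.add 0 (map f l).

Lemma zsum_app {A : Type} (f : A -> Z) l m : zsum f (l ++ m) = zsum f l + zsum f m.
Proof. unfold zsum. induction l; simpl; lia. Qed.

Lemma zsum_ext {A : Type} (f g : A -> Z) l :
  (forall x, In x l -> f x = g x) -> zsum f l = zsum g l.
Proof.
  unfold zsum. induction l as [|x l IH]; simpl; intros H; [reflexivity|].
  rewrite IH; auto. rewrite H; auto.
Qed.

Lemma zsum_le {A : Type} (f g : A -> Z) l :
  (forall x, In x l -> f x <= g x) -> zsum f l <= zsum g l.
Proof.
  unfold zsum. induction l as [|x l IH]; simpl; intros H; [lia|].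
  specialize (IH (fun y Hy => H y (or_intror Hy))). specialize (H x (or_introl eq_refl)). lia.
Qed.

Lemma zsum_add {A : Type} (f g : A -> Z) l : zsum (fun x => f x + g x) l = zsum f l + zsum g l.
Proof. unfold zsum. induction l; simpl; lia. Qed.

Lemma zsum_scale {A : Type} (c : Z) (f : A -> Z) l : zsum (fun x => c * f x) l = c * zsum f l.
Proof. unfold zsum. induction l; simpl; lia. Qed.

Lemma zsum_const {A : Type} (c : Z) (l : list A) : zsum (fun _ => c) l = c * Z.of_nat (length l).
Proof. unfold zsum. induction l as [|x l IH]; simpl length; simpl; lia. Qed.

Lemma zsum_map {A B : Type} (f : B -> Z) (g : A -> B) l : zsum f (map g l) = zsum (fun x => f (g x)) l.
Proof. unfold zsum. now rewrite map_map. Qed.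

Lemma zsum_ge_term {A : Type} (f : A -> Z) l x :
  (forall y, In y l -> 0 <= f y) -> In x l -> f x <= zsum f l.
Proof.
  unfold zsum. induction l as [|y l IH]; simpl; intros H Hx; [tauto|].
  assert (0 <= fold_right Z.add 0 (map f l)).
  { assert (zsum (fun _ => 0) l <= zsum f l) as E by (apply zsum_le; auto).
    rewrite zsum_const in E. unfold zsum in E. lia. }
  destruct Hx as [->|Hx]; [lia|].
  specialize (IH (fun z Hz => H z (or_intror Hz)) Hx). specialize (H y (or_introl eq_refl)). lia.
Qed.

Lemma zsum_list_prod {A B : Type} (f : B -> Z) (l : list A) (m : list B) :
  zsum (fun p => f (snd p)) (list_prod l m) = Z.of_nat (length l) * zsum f m.
Proof.
  induction l as [|x l IH]; [reflexivity|].
  simpl list_prod. rewrite zsum_app, IH, zsum_map. simpl snd. simpl length.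
  change (zsum (fun x0 => f x0) m) with (zsum f m). lia.
Qed.

(** * Towers and alternations across a line *)

Definition scale (K : Z) (p : point) : Z := fst p mod K.
Definition time (K : Z) (p : point) : Z := snd p / K.

(* The [scale j], [time t] point of a tower lies at [x = K t + K 2^j + j], and in the
   band [K t <= y < K (t + 1)]. *)
Definition tower (K : Z) (S : list point) : Prop :=
  NoDup S /\
  (forall p, In p S -> fst p = K * time K p + K * 2 ^ scale K p + scale K p) /\
  (forall p q, In p S -> In q S -> fst p = fst q -> p = q) /\
  (forall p q, In p S -> In q S -> snd p = snd q -> p = q).

Lemma tower_filter K S f : tower K S -> tower K (filter f S).
Proof.
  intros (H1 & H2 & H3 & H4). split; [now apply NoDup_filter|].
  split; [|split].
  - intros p Hp. apply filter_In in Hp. now apply H2.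
  - intros p q Hp Hq. apply filter_In in Hp, Hq. now apply H3.
  - intros p q Hp Hq. apply filter_In in Hp, Hq. now apply H4.
Qed.

(** The list whose length is [charge S k] by conversion, so that alternations can be counted as
    elements. *)
Definition alternations (S : list point) (k : Z) : list (point * point) :=
  filter (fun ab => consec S (fst ab) (snd ab) && xorb (fst (fst ab) <=? k) (fst (snd ab) <=? k))
    (list_prod S S).

Lemma in_alternations S k p q :
  In (p, q) (alternations S k) <->
  In p S /\ In q S /\ snd p < snd q /\ (forall r, In r S -> ~ (snd p < snd r < snd q)) /\
  (fst p <= k < fst q \/ fst q <= k < fst p).
Proof.
  unfold alternations. rewrite filter_In, in_prod_iff. simpl fst. simpl snd.
  unfold consec. rewrite !andb_true_iff, forallb_forall, Z.ltb_lt.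
  assert (E : xorb (fst p <=? k) (fst q <=? k) = true <->
              (fst p <= k < fst q \/ fst q <= k < fst p)).
  { destruct (Z.leb_spec (fst p) k), (Z.leb_spec (fst q) k); simpl; split; intros; try lia; easy. }
  rewrite E.
  assert (E2 : (forall r, In r S -> negb ((snd p <? snd r) && (snd r <? snd q)) = true) <->
               (forall r, In r S -> ~ (snd p < snd r < snd q))).
  { split; intros H r Hr; specialize (H r Hr);
      destruct (Z.ltb_spec (snd p) (snd r)), (Z.ltb_spec (snd r) (snd q)); simpl in *; try lia; easy. }
  rewrite E2. tauto.
Qed.

(** If [q] and [q'] had different heights, the lower one would lie strictly between [p] and the
    higher one. *)
Lemma alternations_fst_inj S k p q q' :
  (forall p q, In p S -> In q S -> snd p = snd q -> p = q) ->
  In (p, q) (alternations S k) -> In (p, q') (alternations S k) -> q = q'.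
Proof.
  intros Hinj H H'. apply in_alternations in H as (? & ? & ? & N & _).
  apply in_alternations in H' as (? & ? & ? & N' & _).
  apply Hinj; auto. specialize (N q'). specialize (N' q). intuition lia.
Qed.

Lemma alternations_snd_inj S k p p' q :
  (forall p q, In p S -> In q S -> snd p = snd q -> p = q) ->
  In (p, q) (alternations S k) -> In (p', q) (alternations S k) -> p = p'.
Proof.
  intros Hinj H H'. apply in_alternations in H as (? & ? & ? & N & _).
  apply in_alternations in H' as (? & ? & ? & N' & _).
  apply Hinj; auto. specialize (N p'). specialize (N' p). intuition lia.
Qed.

Lemma scale_bound K p : 0 < K -> 0 <= scale K p < K.
Proof. intros H. now apply Z.mod_pos_bound. Qed.

Lemma time_lt_snd K p q : 0 < K -> time K p < time K q -> snd p < snd q.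
Proof.
  unfold time. intros HK H. pose proof (Z.div_mod (snd p) K). pose proof (Z.div_mod (snd q) K).
  pose proof (Z.mod_pos_bound (snd p) K). pose proof (Z.mod_pos_bound (snd q) K). nia.
Qed.

Lemma snd_lt_time K p q : 0 < K -> snd p < snd q -> time K p <= time K q.
Proof. intros HK H. apply Z.div_le_mono; lia. Qed.

Lemma pow2_double i j : 0 <= i < j -> 2 * 2 ^ i <= 2 ^ j.
Proof.
  intros H. rewrite <- Z.pow_succ_r by lia. apply Z.pow_le_mono_r; lia.
Qed.

(** * Charge of a cut with a narrow part or in a narrow strip *)

Definition in_strip (S : list point) (a b : Z) : Prop := forall p, In p S -> a < fst p <= b.

(* Seen from a narrow strip the scale-[j] point of a copy crosses the strip as time
   passes, and larger scales cross before smaller ones. *)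
Lemma larger_scale_first K S a b p q :
  0 < K -> tower K S -> in_strip S a b ->
  In p S -> In q S -> scale K q < scale K p -> 2 * (b - a) <= K * 2 ^ scale K p ->
  time K p < time K q.
Proof.
  intros HK HS Hab Hp Hq Hsc Hw. destruct HS as (_ & Hx & _).
  pose proof (Hx p Hp). pose proof (Hx q Hq). pose proof (Hab p Hp). pose proof (Hab q Hq).
  pose proof (scale_bound K p HK). pose proof (scale_bound K q HK).
  assert (2 * 2 ^ scale K q <= 2 ^ scale K p) by (apply pow2_double; lia).
  nia.
Qed.

Lemma NoDup_alternations S k : NoDup S -> NoDup (alternations S k).
Proof. intros H. now apply NoDup_filter, NoDup_list_prod. Qed.

(** [(c, c + w1]] is one of the two parts. Every alternation has an endpoint there, each of its [w1]
    abscissae carries at most one point, and a point is in at most two alternations, once as the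
    lower and once as the upper point. *)
Lemma charge_le_width K S a b k c w1 :
  0 < K -> tower K S -> in_strip S a b -> 0 <= w1 ->
  (c = a /\ c + w1 = k \/ c = k /\ c + w1 = b) ->
  Z.of_nat (charge S k) <= 2 * w1.
Proof.
  intros HK (Hnd & Hx & Hfi & Hsi) Hab Hw1 Hc.
  assert (H : (length (alternations S k) <=
               length (list_prod [true; false] (zint c (c + w1))))%nat).
  { apply (rel_inj_length (fun e d => fst (if fst d : bool then fst e else snd e) = snd d)).
    - now apply NoDup_alternations.
    - intros [p q] He. apply in_alternations in He as (Hp & Hq & _ & _ & Hk).
      pose proof (Hab p Hp). pose proof (Hab q Hq).
      assert (c < fst p <= c + w1 \/ c < fst q <= c + w1) as [E|E] by lia.
      + exists (true, fst p). rewrite in_prod_iff, in_zint. simpl. auto.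
      + exists (false, fst q). rewrite in_prod_iff, in_zint. simpl. auto.
    - intros [p q] [p' q'] [r x] He He'. pose proof He as He0. pose proof He' as He0'.
      apply in_alternations in He0 as (Hp & Hq & _), He0' as (Hp' & Hq' & _).
      destruct r; simpl; intros E E'.
      + assert (p = p') by (apply Hfi; congruence). subst p'.
        f_equal. eapply alternations_fst_inj; eauto.
      + assert (q = q') by (apply Hfi; congruence). subst q'.
        f_equal. eapply alternations_snd_inj; eauto. }
  rewrite length_prod, length_zint in H. simpl length in H.
  change (length (alternations S k)) with (charge S k) in H. lia.
Qed.

(* All scales are isolated here, so the points sorted by height have decreasing scale; the
   abscissae then decrease, except for one jump between two adjacent columns of width [K]. *)
Lemma charge_le_3 K S a b k :
  0 < K -> tower K S -> in_strip S a b -> 2 * (b - a) <= K ->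
  (charge S k <= 3)%nat.
Proof.
  intros HK HS Hab Hw. pose proof HS as (Hnd & Hx & Hfi & Hsi).
  set (u := (a + 1) / K). set (v := fun p : point => time K p + 2 ^ scale K p).
  assert (Hv : forall p, In p S -> fst p = K * v p + scale K p) by
    (intros p Hp; unfold v; rewrite (Hx p Hp) at 1; ring).
  assert (Huv : forall p, In p S -> v p = u \/ v p = u + 1).
  { intros p Hp. pose proof (Hab p Hp). pose proof (Hv p Hp). pose proof (scale_bound K p HK).
    pose proof (Z.div_mod (a + 1) K). pose proof (Z.mod_pos_bound (a + 1) K). fold u in H2.
    assert (u <= v p <= u + 1); [|lia]. split; nia. }
  assert (Hpow : forall p, K <= K * 2 ^ scale K p).
  { intros p. pose proof (scale_bound K p HK). assert (0 < 2 ^ scale K p) by (apply Z.pow_pos_nonneg; lia). nia. }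
  assert (Hord : forall p q, In p S -> In q S -> snd p < snd q -> scale K q < scale K p).
  { intros p q Hp Hq Hs. destruct (Z.lt_trichotomy (scale K q) (scale K p)) as [E|[E|E]]; [exact E| |].
    - exfalso. assert (p = q); [|subst; lia]. apply Hfi; auto.
      pose proof (Hv p Hp). pose proof (Hv q Hq). pose proof (Hab p Hp). pose proof (Hab q Hq).
      rewrite H, H0, E. f_equal. f_equal. nia.
    - exfalso. assert (time K q < time K p).
      { apply (larger_scale_first K S a b); auto. specialize (Hpow q). lia. }
      apply time_lt_snd in H; lia. }
  assert (Hord' : forall p q, In p S -> In q S -> scale K q < scale K p -> snd p < snd q).
  { intros p q Hp Hq Hs. apply (time_lt_snd K); auto.
    apply (larger_scale_first K S a b); auto. specialize (Hpow p). lia. }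
  assert (Hcol : forall p q, In p S -> In q S -> v p = u -> v q = u + 1 -> scale K q < scale K p).
  { intros p q Hp Hq E E'. pose proof (Hv p Hp). pose proof (Hv q Hq).
    pose proof (Hab p Hp). pose proof (Hab q Hq). nia. }
  (* The possible pairs of columns: a step from column [u + 1] back to [u] would increase the scale,
     by [Hcol]. Each pair of columns occurs for at most one alternation. *)
  change (length (alternations S k) <= length [(u, u); (u, u + 1)%Z; (u + 1, u + 1)%Z])%nat.
  apply (rel_inj_length (fun e d => v (fst e) = fst d /\ v (snd e) = snd d)).
  - now apply NoDup_alternations.
  - intros [p q] He. apply in_alternations in He as (Hp & Hq & Hs & _ & Hk).
    exists (v p, v q). split; [|auto].
    specialize (Hord p q Hp Hq Hs). specialize (Hcol q p Hq Hp).
    destruct (Huv p Hp) as [E|E], (Huv q Hq) as [E'|E']; rewrite E, E'; simpl; auto.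
    specialize (Hcol E' E). lia.
  - assert (Key : forall p q p' q', In (p, q) (alternations S k) -> In (p', q') (alternations S k) ->
       v p = v p' -> v q = v q' -> ~ snd p < snd p').
    { intros p q p' q' He He' Ep Eq Hlt.
      apply in_alternations in He as (Hp & Hq & Hs & N & Hk).
      apply in_alternations in He' as (Hp' & Hq' & Hs' & N' & Hk').
      apply (N p' Hp'). split; [exact Hlt|]. apply Hord'; auto.
      pose proof (Hord p q Hp Hq Hs). pose proof (Hord p' q' Hp' Hq' Hs').
      pose proof (Hv p Hp). pose proof (Hv q Hq). pose proof (Hv p' Hp'). pose proof (Hv q' Hq').
      destruct (Huv p Hp) as [E|E], (Huv q Hq) as [E'|E'].
      - assert (v p = v q) by lia. nia.
      - apply Hcol; auto. lia.
      - pose proof (Hcol q p Hq Hp E' E). lia.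
      - assert (v p = v q) by lia. nia. }
    intros [p q] [p' q'] [d1 d2] He He' [E1 E2] [E1' E2']. simpl in *.
    assert (p = p').
    { apply in_alternations in He as He0. apply in_alternations in He' as He0'.
      apply Hsi; try tauto.
      pose proof (Key p q p' q' He He'). pose proof (Key p' q' p q He' He).
      intuition lia. }
    subst p'. f_equal. eapply alternations_fst_inj; eauto.
Qed.

(** * Charge of a cut with a part of width at least [K] *)

(** Holds the quotients [t], not the multiples [K * t] themselves: these are the times of the copies
    with origin in [(lo, hi]]. *)
Definition multiples (K lo hi : Z) : list Z := zint (lo / K) (hi / K).

Lemma in_multiples K lo hi t : 0 < K -> In t (multiples K lo hi) <-> lo < K * t <= hi.
Proof.
  intros HK. unfold multiples. rewrite in_zint.
  pose proof (Z.div_mod lo K). pose proof (Z.mod_pos_bound lo K).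
  pose proof (Z.div_mod hi K). pose proof (Z.mod_pos_bound hi K). split; intros; nia.
Qed.

Lemma length_multiples K lo hi :
  0 < K -> lo <= hi -> K * Z.of_nat (length (multiples K lo hi)) <= hi - lo + K.
Proof.
  intros HK Hle. unfold multiples. rewrite length_zint.
  pose proof (Z.div_mod lo K). pose proof (Z.mod_pos_bound lo K).
  pose proof (Z.div_mod hi K). pose proof (Z.mod_pos_bound hi K).
  assert (lo / K <= hi / K) by (apply Z.div_le_mono; lia). rewrite Z2Nat.id by lia. nia.
Qed.

(** Up to a constant, [K] times the number of alternations allotted to scale [j] when a part of
    width [w1] is cut off a strip of width [w]. *)
Definition separation (K w w1 j : Z) : Z := if K * 2 ^ j <? 2 * w then Z.min w1 (K * 2 ^ j) else 0.

(* Times of the points of scale [j] that can take part in an alternation across [k] with a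
   point of the strip [(c, c + w1]] in the same copy, or lie in that strip themselves. *)
Definition crossing_times (K w w1 c k j : Z) : list Z :=
  if K * 2 ^ j <? 2 * w then
    if K * 2 ^ j <? w1 then multiples K (k - K * 2 ^ j - j) (k - 1)
    else multiples K (c - K * 2 ^ j - j) (c + w1 - K * 2 ^ j - j)
         ++ multiples K (c - w1 - K) (c + w1)
  else [].

Lemma pow2_pos j : 0 <= j -> 0 < 2 ^ j.
Proof. intros. apply Z.pow_pos_nonneg; lia. Qed.

(** The factor 6 comes from the two intervals of lengths [w1] and [2 * w1 + K]: with a rounding term
    [K] each they give [3 * w1 + 3 * K], and [K <= w1]. For scales below [w1] the bound uses
    [j < K <= K * 2 ^ j]. *)
Lemma length_crossing_times K w w1 c k j :
  0 <= j < K -> K <= w1 ->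
  K * Z.of_nat (length (crossing_times K w w1 c k j)) <= 6 * separation K w w1 j.
Proof.
  intros Hj Hw1. unfold crossing_times, separation.
  pose proof (pow2_pos j (proj1 Hj)).
  destruct (Z.ltb_spec (K * 2 ^ j) (2 * w)); [|simpl length; lia].
  destruct (Z.ltb_spec (K * 2 ^ j) w1).
  - pose proof (length_multiples K (k - K * 2 ^ j - j) (k - 1)). nia.
  - rewrite length_app, Nat2Z.inj_add.
    pose proof (length_multiples K (c - K * 2 ^ j - j) (c + w1 - K * 2 ^ j - j)).
    pose proof (length_multiples K (c - w1 - K) (c + w1)). lia.
Qed.

(** Here [s] lies in the part [(c, c + w1]]. If its scale has [K * 2 ^ j >= w1], its position alone
    confines its time. Otherwise its copy starts within [w1 + K] to the left of the part or inside
    it; then either [g] belongs to another copy, or [g] shares this confined time. *)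
Lemma crossing_times_cover K S a b k c w1 s g :
  0 < K -> tower K S -> in_strip S a b -> In s S -> In g S -> 0 <= w1 ->
  (fst s <= k < fst g \/ fst g <= k < fst s) ->
  K * 2 ^ scale K s < 2 * (b - a) -> K * 2 ^ scale K g < 2 * (b - a) ->
  c < fst s <= c + w1 ->
  (exists r, (r = s \/ r = g) /\
     In (time K r) (crossing_times K (b - a) w1 c k (scale K r))) \/
  (time K s <> time K g /\ In (time K s) (multiples K (c - w1 - K) (c + w1))).
Proof.
  intros HK (_ & Hx & _) Hab Hs Hg Hw1 Hk Is Ig Hc.
  pose proof (Hx s Hs) as Xs. pose proof (Hx g Hg) as Xg.
  pose proof (scale_bound K s HK). pose proof (scale_bound K g HK).
  pose proof (pow2_pos (scale K s) ltac:(lia)). pose proof (pow2_pos (scale K g) ltac:(lia)).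
  unfold crossing_times.
  destruct (Z.ltb_spec (K * 2 ^ scale K s) w1) as [Ls|Ls].
  2:{ left. exists s. split; [auto|].
      destruct (Z.ltb_spec (K * 2 ^ scale K s) (2 * (b - a))); [|lia].
      destruct (Z.ltb_spec (K * 2 ^ scale K s) w1); [lia|].
      apply in_or_app. left. apply in_multiples; lia. }
  assert (Hr : c - w1 - K < K * time K s <= c + w1) by nia.
  destruct (Z.eq_dec (time K s) (time K g)) as [Et|Et].
  2:{ right. split; [exact Et|]. now apply in_multiples. }
  left.
  destruct (Z.ltb_spec (K * 2 ^ scale K g) w1) as [Lg|Lg].
  2:{ exists g. split; [auto|].
      destruct (Z.ltb_spec (K * 2 ^ scale K g) (2 * (b - a))); [|lia].
      destruct (Z.ltb_spec (K * 2 ^ scale K g) w1); [lia|].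
      apply in_or_app. right. apply in_multiples; lia. }
  (* Both scales are now small and the copy is the same. Its origin is left of the line because one
     of the points is, and is at most [K * 2 ^ j + j] away, [j] being the scale of the point on the
     right. *)
  destruct Hk as [Hk|Hk].
  - exists g. split; [auto|].
    destruct (Z.ltb_spec (K * 2 ^ scale K g) (2 * (b - a))); [|lia].
    destruct (Z.ltb_spec (K * 2 ^ scale K g) w1); [|lia].
    apply in_multiples; nia.
  - exists s. split; [auto|].
    destruct (Z.ltb_spec (K * 2 ^ scale K s) (2 * (b - a))); [|lia].
    destruct (Z.ltb_spec (K * 2 ^ scale K s) w1); [|lia].
    apply in_multiples; nia.
Qed.

(* Codes that determine an alternation [(p, q)]. [Late]: the scale and time of [p] or of [q].
   [Jump]: the pair leaves the copy of [p] (enters that of [q]), hence [p] is the last point of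
   its copy in the strip ([q] the first). [Early]: [p] has a scale too large for the strip, and
   is its last point of that scale, or the one where that scale crosses the line. *)
Inductive code := Late (first : bool) (j t : Z) | Jump (first : bool) (t : Z) | Early (same : bool) (j : Z).

Definition encodes (K w : Z) (e : point * point) (d : code) : Prop :=
  match d with
  | Late first j t => let p := if first then fst e else snd e in scale K p = j /\ time K p = t
  | Jump first t => time K (fst e) <> time K (snd e) /\
                    time K (if first then fst e else snd e) = t
  | Early same j => 2 * w <= K * 2 ^ scale K (fst e) /\ scale K (fst e) = j /\
                    (if same then scale K (snd e) = j else scale K (snd e) < j)
  end.

(** One shared endpoint is enough, since it determines the other. [Late] determines a point by scale
    and time; [Jump] singles out the extreme point of a copy. *)
Lemma encodes_fst K S a b k e e' d :
  0 < K -> tower K S -> in_strip S a b -> In e (alternations S k) -> In e' (alternations S k) ->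
  encodes K (b - a) e d -> encodes K (b - a) e' d ->
  fst e = fst e' \/ snd e = snd e'.
Proof.
  intros HK HS Hab. pose proof HS as (Hnd & Hx & Hfi & Hsi).
  assert (Hrec : forall p q, In p S -> In q S -> scale K p = scale K q -> time K p = time K q -> p = q).
  { intros p q Hp Hq E E'. apply Hfi; auto. rewrite (Hx p Hp), (Hx q Hq), E, E'. reflexivity. }
  destruct e as [p q], e' as [p' q']. intros He He'.
  pose proof He as He0. pose proof He' as He0'.
  apply in_alternations in He0 as (Hp & Hq & Hs & N & Hk).
  apply in_alternations in He0' as (Hp' & Hq' & Hs' & N' & Hk').
  pose proof (snd_lt_time K p q HK Hs). pose proof (snd_lt_time K p' q' HK Hs').
  destruct d as [[] j t|[] t|[] j]; unfold encodes; simpl fst; simpl snd.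
  - intros [E1 E2] [E1' E2']. left. apply Hrec; congruence.
  - intros [E1 E2] [E1' E2']. right. apply Hrec; congruence.
  - intros [E1 E2] [E1' E2']. left. apply Hsi; auto.
    destruct (Z.lt_trichotomy (snd p) (snd p')) as [L|[L|L]]; [|exact L|]; exfalso.
    + apply (N p' Hp'). split; [exact L|]. apply (time_lt_snd K); lia.
    + apply (N' p Hp). split; [exact L|]. apply (time_lt_snd K); lia.
  - intros [E1 E2] [E1' E2']. right. apply Hsi; auto.
    destruct (Z.lt_trichotomy (snd q) (snd q')) as [L|[L|L]]; [|exact L|]; exfalso.
    + apply (N' q Hq). split; [|exact L]. apply (time_lt_snd K); lia.
    + apply (N q' Hq'). split; [|exact L]. apply (time_lt_snd K); lia.
  (* Points of one scale move right as time passes, so this scale crosses the line only once. *)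
  - intros (I & E1 & E2) (I' & E1' & E2'). left. apply Hsi; auto.
    assert (Hmono : forall r s, In r S -> In s S -> scale K r = j -> scale K s = j -> fst r < fst s -> snd r < snd s).
    { intros r s Hr Hs0 Er Es L. apply (time_lt_snd K); auto.
      pose proof (Hx r Hr) as Xr. pose proof (Hx s Hs0) as Xs. rewrite Er in Xr. rewrite Es in Xs. nia. }
    assert (fst p <= k < fst q).
    { destruct Hk as [|Hk]; auto. assert (snd q < snd p) by (apply Hmono; auto; lia). lia. }
    assert (fst p' <= k < fst q').
    { destruct Hk' as [|Hk']; auto. assert (snd q' < snd p') by (apply Hmono; auto; lia). lia. }
    destruct (Z.lt_trichotomy (snd p) (snd p')) as [L|[L|L]]; [|exact L|]; exfalso.
    + apply (N p' Hp'). split; [exact L|]. apply Hmono; auto; lia.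
    + apply (N' p Hp). split; [exact L|]. apply Hmono; auto; lia.
  (* A later point of the scale of [p] would still precede [q], whose scale is smaller, and so would
     separate [p] from [q]. *)
  - intros (I & E1 & E2) (I' & E1' & E2'). left. apply Hsi; auto.
    destruct (Z.lt_trichotomy (snd p) (snd p')) as [L|[L|L]]; [|exact L|]; exfalso.
    + apply (N p' Hp'). split; [exact L|]. apply (time_lt_snd K); auto.
      apply (larger_scale_first K S a b); auto. lia.
    + apply (N' p Hp). split; [exact L|]. apply (time_lt_snd K); auto.
      apply (larger_scale_first K S a b); auto. lia.
Qed.

Definition scales (K : Z) : list Z := zint (-1) (K - 1).

Definition codes (K w w1 c k : Z) : list code :=
  flat_map (fun j => map (Late true j) (crossing_times K w w1 c k j)) (scales K) ++
  flat_map (fun j => map (Late false j) (crossing_times K w w1 c k j)) (scales K) ++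
  map (Jump true) (multiples K (c - w1 - K) (c + w1)) ++
  map (Jump false) (multiples K (c - w1 - K) (c + w1)) ++
  map (Early true) (scales K) ++ map (Early false) (scales K).

Lemma in_codes K w w1 c k d :
  In d (codes K w w1 c k) <->
  match d with
  | Late _ j t => In j (scales K) /\ In t (crossing_times K w w1 c k j)
  | Jump _ t => In t (multiples K (c - w1 - K) (c + w1))
  | Early _ j => In j (scales K)
  end.
Proof.
  unfold codes. rewrite !in_app_iff. split.
  - intros [H|[H|[H|[H|[H|H]]]]];
      try (apply in_flat_map in H as (j & Hj & H));
      apply in_map_iff in H as (t & <- & H); auto.
  - destruct d as [[] j t|[] t|[] j]; intros H;
      [left|right; left|do 2 right; left|do 3 right; left|do 4 right; left|do 5 right];
      try (apply in_flat_map; exists j; split; [apply H|]); apply in_map; apply H.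
Qed.

Lemma length_flat_map_zsum {A B : Type} (f : A -> list B) l :
  Z.of_nat (length (flat_map f l)) = zsum (fun x => Z.of_nat (length (f x))) l.
Proof.
  unfold zsum. induction l as [|x l IH]; simpl; [reflexivity|].
  rewrite length_app, Nat2Z.inj_add, IH. reflexivity.
Qed.

(** After multiplication by [K], the two [Early] families cost [2 * K * K], the two [Jump] families
    [2 * (2 * w1 + 2 * K) <= 8 * w1], and the two [Late] families 6 times the sum each. *)
Lemma charge_le_separation K S a b k c w1 :
  0 < K -> tower K S -> in_strip S a b -> K <= w1 ->
  (c = a /\ c + w1 = k \/ c = k /\ c + w1 = b) ->
  K * Z.of_nat (charge S k) <=
    2 * K * K + 8 * w1 + 12 * zsum (separation K (b - a) w1) (scales K).
Proof.
  intros HK HS Hab Hw1 Hc.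
  assert (Hscale : forall p, In (scale K p) (scales K)).
  { intros p. apply in_zint. pose proof (scale_bound K p HK). lia. }
  assert (H : (length (alternations S k) <= length (codes K (b - a) w1 c k))%nat).
  { apply (rel_inj_length (encodes K (b - a))).
    - apply NoDup_alternations, HS.
    - intros [p q] He. apply in_alternations in He as (Hp & Hq & Hs & _ & Hk).
      pose proof (snd_lt_time K p q HK Hs) as Ht.
      setoid_rewrite in_codes.
      destruct (Z_lt_le_dec (K * 2 ^ scale K p) (2 * (b - a))) as [Ip|Ip].
      (* The scale of [p] is too large for the strip. A still larger scale of [q] would put [q]
         before [p]. *)
      2:{ destruct (Z.lt_trichotomy (scale K p) (scale K q)) as [L|[L|L]].
          - exfalso. assert (time K q < time K p); [|lia].
            apply (larger_scale_first K S a b); auto.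
            pose proof (scale_bound K p HK).
            pose proof (pow2_double (scale K p) (scale K q)).
            pose proof (pow2_pos (scale K p)). nia.
          - exists (Early true (scale K p)). simpl. auto.
          - exists (Early false (scale K p)). simpl. auto. }
      destruct (Z_lt_le_dec (K * 2 ^ scale K q) (2 * (b - a))) as [Iq|Iq].
      (* Only [q] has too large a scale, hence the larger one of the two, and it should come
         first. *)
      2:{ exfalso. assert (time K q < time K p); [|lia].
          apply (larger_scale_first K S a b); auto.
          apply Z.nle_gt. intros L.
          assert (2 ^ scale K q <= 2 ^ scale K p) by (apply Z.pow_le_mono_r; lia). nia. }
      pose proof (Hab p Hp). pose proof (Hab q Hq).
      assert (c < fst p <= c + w1 \/ c < fst q <= c + w1) as [E|E] by lia.
      + destruct (crossing_times_cover K S a b k c w1 p q) as [(r & [->| ->] & Hr)|[Hr1 Hr2]]; auto; [lia|..].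
        * exists (Late true (scale K p) (time K p)). simpl. auto.
        * exists (Late false (scale K q) (time K q)). simpl. auto.
        * exists (Jump true (time K p)). simpl. auto.
      + destruct (crossing_times_cover K S a b k c w1 q p) as [(r & [->| ->] & Hr)|[Hr1 Hr2]]; auto; [lia|lia|..].
        * exists (Late false (scale K q) (time K q)). simpl. auto.
        * exists (Late true (scale K p) (time K p)). simpl. auto.
        * exists (Jump false (time K q)). simpl. auto.
    - intros e e' d He He' Hd Hd'.
      pose proof (encodes_fst K S a b k e e' d HK HS Hab He He' Hd Hd').
      destruct HS as (_ & _ & _ & Hsi). destruct e as [p q], e' as [p' q']. simpl in H.
      destruct H; subst; f_equal.
      + eapply alternations_fst_inj; eauto.
      + eapply alternations_snd_inj; eauto. }
  change (length (alternations S k)) with (charge S k) in H.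
  apply Nat2Z.inj_le in H.
  unfold codes in H. rewrite !length_app, !Nat2Z.inj_add, !length_flat_map_zsum, !length_map in H.
  assert (Hlen : forall first,
    K * zsum (fun j => Z.of_nat (length (map (Late first j) (crossing_times K (b - a) w1 c k j)))) (scales K)
      <= 6 * zsum (separation K (b - a) w1) (scales K)).
  { intros first. rewrite <- !zsum_scale. apply zsum_le. intros j Hj. rewrite length_map.
    apply length_crossing_times; [|lia]. apply in_zint in Hj. lia. }
  pose proof (Hlen true). pose proof (Hlen false).
  pose proof (length_multiples K (c - w1 - K) (c + w1) HK).
  assert (Z.of_nat (length (scales K)) = K) by (unfold scales; rewrite length_zint; lia).
  nia.
Qed.

(** * A superadditive potential that pays for every cut *)

Definition excess (K w j : Z) : Z := Z.max 0 (4 * w - K * 2 ^ j).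

(** The terms pay, in this order, for [Late] codes, for [Jump] codes, for [Early] codes or a part
    narrower than [K], and for the constant charge in strips of width at most [K / 2]. The factor
    [w - 1] counts the lines inside the strip and drops by one at each cut. *)
Definition potential (K w : Z) : Z :=
  12 * zsum (excess K w) (scales K) + 8 * zsum (excess K w) (scales (K + 1))
  + 2 * K * excess K w 0 + 3 * K * (w - 1).

(** Put [D = K * 2 ^ j] and [w = wa + wb]. If both parts have positive excess, merging saves one
    subtraction of [D]; if only one has, merging gains 4 times the other width; if none has,
    [D < 2 * w] leaves [4 * w - D > 2 * w]. *)
Lemma excess_add K wa wb j :
  0 < K -> 0 <= j -> 0 <= wa -> 0 <= wb ->
  excess K wa j + excess K wb j + separation K (wa + wb) (Z.min wa wb) j <= excess K (wa + wb) j.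
Proof.
  intros HK Hj Ha Hb. unfold excess, separation. pose proof (pow2_pos j Hj).
  assert (0 < K * 2 ^ j) by nia.
  destruct (Z.ltb_spec (K * 2 ^ j) (2 * (wa + wb))); lia.
Qed.

Lemma zsum_excess_add K wa wb l :
  0 < K -> 0 <= wa -> 0 <= wb -> (forall j, In j l -> 0 <= j) ->
  zsum (excess K wa) l + zsum (excess K wb) l + zsum (separation K (wa + wb) (Z.min wa wb)) l
    <= zsum (excess K (wa + wb)) l.
Proof.
  intros HK Ha Hb Hl. rewrite <- !zsum_add. apply zsum_le. intros j Hj. apply excess_add; auto.
Qed.

Lemma power_between K w1 n :
  K <= w1 -> w1 <= K * 2 ^ Z.of_nat n -> 0 < K ->
  exists j, 0 <= j <= Z.of_nat n /\ w1 <= K * 2 ^ j < 2 * w1.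
Proof.
  intros H1 H2 HK. induction n as [|n IH].
  - change (2 ^ Z.of_nat 0) with 1 in H2. exists 0. rewrite Z.pow_0_r. lia.
  - rewrite Nat2Z.inj_succ, Z.pow_succ_r in H2 by lia.
    destruct (Z_le_gt_dec w1 (K * 2 ^ Z.of_nat n)) as [H|H].
    + destruct (IH H) as (j & Hj & Hj'). exists j. lia.
    + exists (Z.of_nat (S n)). rewrite Nat2Z.inj_succ, Z.pow_succ_r by lia. lia.
Qed.

Lemma separation_nonneg K w w1 j : 0 < K -> 0 <= w1 -> 0 <= j -> 0 <= separation K w w1 j.
Proof.
  intros HK H1 Hj. unfold separation. pose proof (pow2_pos j Hj).
  destruct (Z.ltb_spec (K * 2 ^ j) (2 * w)); nia.
Qed.

(** Some scale satisfies [w1 <= K * 2 ^ j < 2 * w1], and its separation is already [w1]. It may be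
    [j = K], whence the range [scales (K + 1)]. *)
Lemma le_zsum_separation K w w1 :
  0 < K -> K <= w1 -> w1 <= w -> w1 <= K * 2 ^ K ->
  w1 <= zsum (separation K w w1) (scales (K + 1)).
Proof.
  intros HK H1 H2 H3.
  destruct (power_between K w1 (Z.to_nat K)) as (j & Hj & Hj'); try lia.
  { now rewrite Z2Nat.id by lia. }
  rewrite Z2Nat.id in Hj by lia.
  apply Z.le_trans with (separation K w w1 j).
  - unfold separation. destruct (Z.ltb_spec (K * 2 ^ j) (2 * w)); lia.
  - apply (zsum_ge_term (separation K w w1)); [|apply in_zint; lia].
    intros y Hy. apply in_zint in Hy. apply separation_nonneg; lia.
Qed.

Lemma zsum_separation_nonneg K w w1 l :
  0 < K -> 0 <= w1 -> (forall j, In j l -> 0 <= j) -> 0 <= zsum (separation K w w1) l.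
Proof.
  intros HK H1 Hl. apply Z.le_trans with (zsum (fun _ => 0) l).
  - rewrite zsum_const. lia.
  - apply zsum_le. intros j Hj. apply separation_nonneg; auto.
Qed.

Lemma scales_nonneg K j : In j (scales K) -> 0 <= j.
Proof. intros H. apply in_zint in H. lia. Qed.

(** Three regimes: width at most [K / 2], where the charge is at most 3; a smaller part below [K],
    where it is at most [2 * w1]; and a smaller part of at least [K], where the codes apply. In the
    last two the separation at scale 0 is [Z.min w1 K]. *)
Lemma potential_split K S a b k :
  0 < K -> tower K S -> in_strip S a b -> a < k < b -> b - a <= 2 * K * 2 ^ K ->
  K * Z.of_nat (charge S k) + potential K (k - a) + potential K (b - k) <= potential K (b - a).
Proof.
  intros HK HS Hab Hk HW.
  set (w1 := Z.min (k - a) (b - k)).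
  assert (Hc : exists c, c = a /\ c + w1 = k \/ c = k /\ c + w1 = b).
  { destruct (Z_le_gt_dec (k - a) (b - k)); [exists a|exists k]; lia. }
  destruct Hc as (c & Hc).
  pose proof (zsum_excess_add K (k - a) (b - k) (scales K) HK ltac:(lia) ltac:(lia) (scales_nonneg _)) as E1.
  pose proof (zsum_excess_add K (k - a) (b - k) (scales (K + 1)) HK ltac:(lia) ltac:(lia) (scales_nonneg _)) as E2.
  pose proof (excess_add K (k - a) (b - k) 0 HK ltac:(lia) ltac:(lia) ltac:(lia)) as E3.
  fold w1 in E1, E2, E3. replace (k - a + (b - k)) with (b - a) in E1, E2, E3 by lia.
  assert (N1 := zsum_separation_nonneg K (b - a) w1 (scales K) HK ltac:(lia) (scales_nonneg _)).
  assert (N2 := zsum_separation_nonneg K (b - a) w1 (scales (K + 1)) HK ltac:(lia) (scales_nonneg _)).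
  assert (N3 := separation_nonneg K (b - a) w1 0 HK ltac:(lia) ltac:(lia)).
  assert (Hmain : K * Z.of_nat (charge S k) <=
     12 * zsum (separation K (b - a) w1) (scales K) +
     8 * zsum (separation K (b - a) w1) (scales (K + 1)) +
     2 * K * separation K (b - a) w1 0 + 3 * K).
  { destruct (Z_le_gt_dec (2 * (b - a)) K) as [Hw|Hw].
    - pose proof (charge_le_3 K S a b k HK HS Hab Hw). nia.
    - assert (E : separation K (b - a) w1 0 = Z.min w1 K).
      { unfold separation. rewrite Z.pow_0_r, Z.mul_1_r.
        destruct (Z.ltb_spec K (2 * (b - a))); lia. }
      rewrite E in *.
      destruct (Z_lt_le_dec w1 K) as [L|L].
      + pose proof (charge_le_width K S a b k c w1 HK HS Hab ltac:(lia) Hc). nia.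
      + pose proof (charge_le_separation K S a b k c w1 HK HS Hab L Hc).
        pose proof (le_zsum_separation K (b - a) w1 HK L ltac:(lia) ltac:(lia)). nia. }
  unfold potential. nia.
Qed.

Lemma potential_nonneg K w : 0 < K -> 1 <= w -> 0 <= potential K w.
Proof.
  intros HK Hw.
  assert (H : forall l, 0 <= zsum (excess K w) l).
  { intros l. apply Z.le_trans with (zsum (fun _ => 0) l).
    - rewrite zsum_const. lia.
    - apply zsum_le. intros j _. unfold excess. lia. }
  unfold potential. pose proof (H (scales K)). pose proof (H (scales (K + 1))).
  assert (0 <= excess K w 0) by (unfold excess; lia). nia.
Qed.

(** The constant is 48 + 64 + 8 + 3, using [K + 1 <= 2 * K] in the second term. *)
Lemma potential_le K w : 1 <= K -> 1 <= w -> potential K w <= 123 * K * w.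
Proof.
  intros HK Hw.
  assert (H : forall K', 0 <= K' -> zsum (excess K w) (scales K') <= 4 * w * K').
  { intros K' HK'. apply Z.le_trans with (zsum (fun _ => 4 * w) (scales K')).
    - apply zsum_le. intros j Hj. unfold excess. pose proof (pow2_pos j (scales_nonneg _ _ Hj)). nia.
    - rewrite zsum_const. unfold scales. rewrite length_zint. lia. }
  unfold potential. pose proof (H K). pose proof (H (K + 1)).
  assert (excess K w 0 <= 4 * w) by (unfold excess; change (2 ^ 0) with 1; lia). nia.
Qed.

(** Each cut is paid by the loss of potential, and the potential left when the recursion stops is
    nonnegative. *)
Lemma wbrec_le_potential K fuel : forall S sigma a b,
  0 < K -> tower K S -> in_strip S a b -> (forall l, In l sigma -> a < l < b) -> a < b ->
  b - a <= 2 * K * 2 ^ K ->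
  K * Z.of_nat (wbrec fuel S sigma) <= potential K (b - a).
Proof.
  induction fuel as [|fuel IH]; intros S sigma a b HK HS Hab Hsig Hlt HW.
  - simpl. pose proof (potential_nonneg K (b - a)). lia.
  - destruct sigma as [|k sigma].
    + simpl. pose proof (potential_nonneg K (b - a)). lia.
    + simpl wbrec. rewrite !Nat2Z.inj_add.
      assert (Hk : a < k < b) by (apply Hsig; simpl; auto).
      pose proof (potential_split K S a b k HK HS Hab Hk HW).
      assert (K * Z.of_nat (wbrec fuel (filter (fun q : point => fst q <=? k) S) (filter (fun l => l <? k) sigma))
              <= potential K (k - a)).
      { apply IH; auto; try lia.
        - now apply tower_filter.
        - intros p Hp. apply filter_In in Hp as [Hp E]. apply Z.leb_le in E. specialize (Hab p Hp). lia.
        - intros l Hl. apply filter_In in Hl as [Hl E]. apply Z.ltb_lt in E.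
          specialize (Hsig l (or_intror Hl)). lia. }
      assert (K * Z.of_nat (wbrec fuel (filter (fun q : point => k <? fst q) S) (filter (fun l => k <? l) sigma))
              <= potential K (b - k)).
      { apply IH; auto; try lia.
        - now apply tower_filter.
        - intros p Hp. apply filter_In in Hp as [Hp E]. apply Z.ltb_lt in E. specialize (Hab p Hp). lia.
        - intros l Hl. apply filter_In in Hl as [Hl E]. apply Z.ltb_lt in E.
          specialize (Hsig l (or_intror Hl)). lia. }
      lia.
Qed.

(** * From single cuts to all orderings of the lines *)

Lemma in_insert_everywhere x l m y : In m (insert_everywhere x l) -> In y m -> y = x \/ In y l.
Proof.
  revert m. induction l as [|z l IH]; simpl; intros m Hm Hy.
  - destruct Hm as [<-|[]]. simpl in Hy. intuition.
  - destruct Hm as [<-|Hm].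
    + simpl in Hy. intuition.
    + apply in_map_iff in Hm as (m' & <- & Hm'). destruct Hy as [->|Hy]; [auto|].
      specialize (IH m' Hm' Hy). intuition.
Qed.

Lemma in_perms l m y : In m (perms l) -> In y m -> In y l.
Proof.
  revert m. induction l as [|x l IH]; simpl; intros m Hm Hy.
  - destruct Hm as [<-|[]]. contradiction.
  - apply in_flat_map in Hm as (m' & Hm' & Hm).
    destruct (in_insert_everywhere x m' m y Hm Hy) as [->|H]; eauto.
Qed.

(** Applied to minimum and maximum: the extreme abscissae belong to points, so every line falls
    inside the strip. *)
Lemma fold_left_select {A : Type} (f : A -> A -> A) l x :
  (forall u v, f u v = u \/ f u v = v) -> In (fold_left f l x) (x :: l).
Proof.
  intros Hf. revert x. induction l as [|y l IH]; intros x; simpl; [auto|].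
  destruct (IH (f x y)) as [H|H]; [|auto]. rewrite <- H. destruct (Hf x y) as [-> | ->]; auto.
Qed.

Lemma in_lines X l a b : X <> [] -> in_strip X a b -> In l (lines X) -> a < l < b.
Proof.
  intros HX Hab Hl. unfold lines in Hl. apply in_map_iff in Hl as (i & <- & Hi). apply in_seq in Hi.
  destruct X as [|p X]; [contradiction|].
  assert (In (minx (p :: X)) (map fst (p :: X))) as H1 by
    (apply fold_left_select; intros; lia).
  assert (In (maxx (p :: X)) (map fst (p :: X))) as H2 by
    (apply fold_left_select; intros; lia).
  apply in_map_iff in H1 as (q & Hq & Hq'), H2 as (r & Hr & Hr').
  apply Hab in Hq', Hr'. lia.
Qed.

Lemma fold_right_max_le (l : list nat) n : (forall x, In x l -> (x <= n)%nat) -> (fold_right Nat.max O l <= n)%nat.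
Proof.
  induction l as [|x l IH]; simpl; intros H; [lia|].
  apply Nat.max_lub; auto.
Qed.

Lemma WB_tower_le K X a b :
  0 < K -> X <> [] -> tower K X -> in_strip X a b -> a < b -> b - a <= 2 * K * 2 ^ K ->
  Z.of_nat (WB X) <= 123 * (b - a).
Proof.
  intros HK HX HT Hab Hlt HW.
  assert (WB X <= Z.to_nat (123 * (b - a)))%nat; [|lia].
  apply fold_right_max_le. intros n Hn. apply in_map_iff in Hn as (sigma & <- & Hs).
  assert (H : K * Z.of_nat (WB_sigma X sigma) <= potential K (b - a)).
  { apply wbrec_le_potential; auto. intros l Hl. apply (in_lines X); auto. eapply in_perms; eauto. }
  pose proof (potential_le K (b - a)). nia.
Qed.

(** * Bit reversal and its forks *)

Fixpoint bit_reversal (k : nat) (i : Z) : Z :=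
  match k with
  | O => 0
  | S k' => (i mod 2) * 2 ^ Z.of_nat k' + bit_reversal k' (i / 2)
  end.

(** Even indices come before odd ones, so that sums follow the recursion of [bit_reversal] and
    [forks] on the lowest bit. *)
Fixpoint indices (k : nat) : list Z :=
  match k with
  | O => [0]
  | S k' => map (fun m => 2 * m) (indices k') ++ map (fun m => 2 * m + 1) (indices k')
  end.

(* Pairs [(i - 2^l, i + 2^l)] with the [l]-th bit of [i] set. *)
Fixpoint forks (k : nat) (i : Z) : list (Z * Z) :=
  match k with
  | O => []
  | S k' =>
      map (fun ab => (2 * fst ab + i mod 2, 2 * snd ab + i mod 2)) (forks k' (i / 2)) ++
      (if (i mod 2 =? 1) && (i + 1 <? 2 ^ Z.of_nat (S k')) then [(i - 1, i + 1)] else [])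
  end.

Lemma pow2_S k : 2 ^ Z.of_nat (S k) = 2 * 2 ^ Z.of_nat k.
Proof. rewrite Nat2Z.inj_succ, Z.pow_succ_r; lia. Qed.

Lemma bit_reversal_range k i : 0 <= bit_reversal k i < 2 ^ Z.of_nat k.
Proof.
  revert i. induction k as [|k IH]; intros i; [simpl; lia|].
  rewrite pow2_S. cbn [bit_reversal]. specialize (IH (i / 2)).
  pose proof (Z.mod_pos_bound i 2). nia.
Qed.

Lemma bit_reversal_S k m e :
  0 <= e < 2 -> bit_reversal (S k) (2 * m + e) = e * 2 ^ Z.of_nat k + bit_reversal k m.
Proof.
  intros He. cbn [bit_reversal].
  assert (E : (2 * m + e) mod 2 = e) by (symmetry; apply (Z.mod_unique _ _ m); lia).
  assert (E' : (2 * m + e) / 2 = m) by (symmetry; apply (Z.div_unique _ _ _ e); lia).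
  now rewrite E, E'.
Qed.

Lemma bit_reversal_inj k i j :
  0 <= i < 2 ^ Z.of_nat k -> 0 <= j < 2 ^ Z.of_nat k ->
  bit_reversal k i = bit_reversal k j -> i = j.
Proof.
  revert i j. induction k as [|k IH]; intros i j Hi Hj H; [simpl in *; lia|].
  rewrite pow2_S in *. cbn [bit_reversal] in H.
  pose proof (bit_reversal_range k (i / 2)). pose proof (bit_reversal_range k (j / 2)).
  pose proof (Z.mod_pos_bound i 2). pose proof (Z.mod_pos_bound j 2).
  pose proof (Z.div_mod i 2). pose proof (Z.div_mod j 2).
  assert (i mod 2 = j mod 2) by nia.
  assert (i / 2 = j / 2) by (apply IH; lia). lia.
Qed.

Lemma in_indices k i : In i (indices k) <-> 0 <= i < 2 ^ Z.of_nat k.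
Proof.
  revert i. induction k as [|k IH]; intros i; [simpl; lia|].
  rewrite pow2_S. cbn [indices]. rewrite in_app_iff, !in_map_iff. split.
  - intros [(m & <- & Hm)|(m & <- & Hm)]; apply IH in Hm; lia.
  - intros Hi. pose proof (Z.div_mod i 2). pose proof (Z.mod_pos_bound i 2).
    assert (In (i / 2) (indices k)) by (apply IH; lia).
    destruct (Z.eq_dec (i mod 2) 0); [left|right]; exists (i / 2); split; auto; lia.
Qed.

Lemma NoDup_indices k : NoDup (indices k).
Proof.
  induction k as [|k IH]; cbn [indices]; [repeat constructor; auto|].
  apply NoDup_app; try (apply NoDup_map_NoDup_ForallPairs; [intros x y _ _ E; lia|exact IH]).
  intros x Hx Hy. apply in_map_iff in Hx as (m & <- & _), Hy as (m' & E & _). lia.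
Qed.

Lemma length_indices k : Z.of_nat (length (indices k)) = 2 ^ Z.of_nat k.
Proof.
  induction k as [|k IH]; [reflexivity|].
  rewrite pow2_S. cbn [indices]. rewrite length_app, !length_map. lia.
Qed.

Definition below (k : nat) (e e' : Z * Z) : Prop :=
  Z.max (bit_reversal k (fst e)) (bit_reversal k (snd e)) <
  Z.min (bit_reversal k (fst e')) (bit_reversal k (snd e')).

Lemma forks_double k m e :
  0 <= e < 2 ->
  forks (S k) (2 * m + e) =
    map (fun ab => (2 * fst ab + e, 2 * snd ab + e)) (forks k m) ++
    (if (e =? 1) && (2 * m + e + 1 <? 2 ^ Z.of_nat (S k)) then [(2 * m + e - 1, 2 * m + e + 1)] else []).
Proof.
  intros He. cbn [forks].
  assert (E : (2 * m + e) mod 2 = e) by (symmetry; apply (Z.mod_unique _ _ m); lia).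
  assert (E' : (2 * m + e) / 2 = m) by (symmetry; apply (Z.div_unique _ _ _ e); lia).
  now rewrite E, E'.
Qed.

Lemma double_cases i : exists m e, i = 2 * m + e /\ 0 <= e < 2.
Proof.
  exists (i / 2), (i mod 2). pose proof (Z.div_mod i 2). pose proof (Z.mod_pos_bound i 2). lia.
Qed.

(** For bit [l], both [a] and [b] share the lower [l] bits of [i] and have bit [l] clear, so their
    reversals are smaller. An index strictly between them other than [i] differs from [i] in the
    lower [l] bits, so if it is not above [i] it lies below [a] and [b] too. *)
Lemma forks_spec k i a b :
  0 <= i < 2 ^ Z.of_nat k -> In (a, b) (forks k i) ->
  0 <= a < i /\ i < b < 2 ^ Z.of_nat k /\
  bit_reversal k a < bit_reversal k i /\ bit_reversal k b < bit_reversal k i /\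
  bit_reversal k a <> bit_reversal k b /\
  (forall r, a < r < b -> r <> i -> bit_reversal k r <= bit_reversal k i ->
     bit_reversal k r < Z.min (bit_reversal k a) (bit_reversal k b)).
Proof.
  revert i a b. induction k as [|k IH]; intros i a b Hi Hab; [contradiction|].
  destruct (double_cases i) as (m & e & -> & He).
  rewrite forks_double in Hab by exact He. rewrite pow2_S in *.
  apply in_app_or in Hab as [Hab|Hab].
  - apply in_map_iff in Hab as ((a' & b') & E & Hab). cbn [fst snd] in E; apply pair_equal_spec in E as [<- <-].
    cbn [fst snd].
    destruct (IH m a' b') as (H1 & H2 & H3 & H4 & H5 & H6); [lia|exact Hab|].
    rewrite !bit_reversal_S by exact He.
    do 5 (split; [lia|]).
    intros r Hr Hri. destruct (double_cases r) as (r' & e' & -> & He').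
    rewrite bit_reversal_S by exact He'.
    pose proof (bit_reversal_range k r'). pose proof (bit_reversal_range k m).
    pose proof (bit_reversal_range k a'). pose proof (bit_reversal_range k b').
    assert (e' < e \/ e' = e \/ e < e') as [L|[L|L]] by lia.
    + intros _. assert (e' = 0) by lia. assert (e = 1) by lia. subst. lia.
    + subst e'. intros Hle. assert (bit_reversal k r' < Z.min (bit_reversal k a') (bit_reversal k b')); [|lia].
      apply H6; lia.
    + assert (e' = 1) by lia. assert (e = 0) by lia. subst. lia.
  - destruct (Z.eqb_spec e 1) as [E1|E1]; cbn [andb] in Hab; [subst e|contradiction].
    destruct (Z.ltb_spec (2 * m + 1 + 1) (2 * 2 ^ Z.of_nat k)) as [L|L]; [|destruct Hab].
    destruct Hab as [E|[]]. cbn [fst snd] in E; apply pair_equal_spec in E as [<- <-].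
    replace (2 * m + 1 - 1) with (2 * m + 0) by lia.
    replace (2 * m + 1 + 1) with (2 * (m + 1) + 0) in * by lia.
    rewrite !bit_reversal_S by lia.
    pose proof (bit_reversal_range k m). pose proof (bit_reversal_range k (m + 1)).
    do 4 (split; [lia|]).
    split; [|intros; lia]. intros E. assert (bit_reversal k m = bit_reversal k (m + 1)) as E' by lia.
    apply bit_reversal_inj in E'; lia.
Qed.

(** At the lower of the two bits, one fork has the bit clear and the other keeps the set bit of [i],
    and after reversal this bit decides. Distinct forks thus occupy disjoint ranges of heights. *)
Lemma forks_below k i e e' :
  0 <= i < 2 ^ Z.of_nat k -> In e (forks k i) -> In e' (forks k i) ->
  e = e' \/ below k e e' \/ below k e' e.
Proof.
  revert i e e'. induction k as [|k IH]; intros i e e' Hi He He'; [contradiction|].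
  destruct (double_cases i) as (m & d & -> & Hd).
  rewrite forks_double in He, He' by exact Hd. rewrite pow2_S in *.
  assert (Hold : forall f, In f (map (fun ab => (2 * fst ab + d, 2 * snd ab + d)) (forks k m)) ->
     exists f', In f' (forks k m) /\ f = (2 * fst f' + d, 2 * snd f' + d)).
  { intros f Hf. apply in_map_iff in Hf as (f' & <- & Hf'). eauto. }
  assert (Hnew : forall f, In f (if (d =? 1) && (2 * m + d + 1 <? 2 * 2 ^ Z.of_nat k)
     then [(2 * m + d - 1, 2 * m + d + 1)] else []) -> d = 1 /\ f = (2 * m + 0, 2 * (m + 1) + 0)).
  { intros f Hf. destruct (Z.eqb_spec d 1) as [E1|E1]; cbn [andb] in Hf; [|destruct Hf].
    destruct (2 * m + d + 1 <? _); [|destruct Hf]. destruct Hf as [<-|[]]. split; [exact E1|]. f_equal; lia. }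
  assert (Hnewold : forall f f', d = 1 -> f = (2 * m + 0, 2 * (m + 1) + 0) ->
     below (S k) f (2 * fst f' + d, 2 * snd f' + d)).
  { intros f f' -> ->. unfold below. cbn [fst snd]. rewrite !bit_reversal_S by lia.
    pose proof (bit_reversal_range k m). pose proof (bit_reversal_range k (m + 1)).
    pose proof (bit_reversal_range k (fst f')). pose proof (bit_reversal_range k (snd f')). lia. }
  apply in_app_or in He as [He|He]; apply in_app_or in He' as [He'|He'].
  - apply Hold in He as (f & Hf & ->), He' as (f' & Hf' & ->).
    destruct (IH m f f') as [->|[B|B]]; auto; [lia|right; left|right; right];
      unfold below in *; cbn [fst snd]; rewrite !bit_reversal_S by exact Hd; lia.
  - apply Hold in He as (f & Hf & ->). apply Hnew in He' as [E E']. right; right. auto.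
  - apply Hold in He' as (f & Hf & ->). apply Hnew in He as [E E']. right; left. auto.
  - apply Hnew in He as [_ ->], He' as [_ ->]. auto.
Qed.

Lemma NoDup_forks k i : 0 <= i < 2 ^ Z.of_nat k -> NoDup (forks k i).
Proof.
  revert i. induction k as [|k IH]; intros i Hi; [constructor|].
  destruct (double_cases i) as (m & d & -> & Hd). rewrite pow2_S in Hi.
  rewrite forks_double by exact Hd. apply NoDup_app.
  - apply NoDup_map_NoDup_ForallPairs; [|apply IH; lia].
    intros [u v] [u' v'] _ _ E. cbn [fst snd] in E; apply pair_equal_spec in E as [E1 E2]. f_equal; lia.
  - destruct (_ && _); repeat constructor; auto.
  - intros f Hf Hf'. apply in_map_iff in Hf as ((u & v) & <- & Hf).
    destruct (Z.eqb_spec d 1) as [E1|E1]; cbn [andb] in Hf'; [|destruct Hf'].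
    destruct (2 * m + d + 1 <? _); [|destruct Hf']. destruct Hf' as [E|[]]. cbn [fst snd] in E; apply pair_equal_spec in E as [E2 E3]. lia.
Qed.

Lemma count_not_last k :
  zsum (fun m => if m + 1 <? 2 ^ Z.of_nat k then 1 else 0) (indices k) = 2 ^ Z.of_nat k - 1.
Proof.
  induction k as [|k IH]; [reflexivity|].
  cbn [indices]. rewrite zsum_app, !zsum_map, pow2_S.
  rewrite (zsum_ext _ (fun _ => 1)).
  2:{ intros m Hm. apply in_indices in Hm. destruct (Z.ltb_spec (2 * m + 1) (2 * 2 ^ Z.of_nat k)); lia. }
  rewrite zsum_const, length_indices.
  rewrite (zsum_ext (fun m => if 2 * m + 1 + 1 <? _ then 1 else 0)
                    (fun m => if m + 1 <? 2 ^ Z.of_nat k then 1 else 0)); [lia|].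
  intros m _. destruct (Z.ltb_spec (2 * m + 1 + 1) (2 * 2 ^ Z.of_nat k)), (Z.ltb_spec (m + 1) (2 ^ Z.of_nat k)); lia.
Qed.

(** The indices have [k * 2 ^ (k - 1)] set bits in all. Bit [l] gives no fork when all bits from [l]
    upward are set, which happens for [2 ^ l] indices, in total [2 ^ k - 1]. *)
Lemma sum_forks k :
  2 * zsum (fun i => Z.of_nat (length (forks k i))) (indices k) =
  Z.of_nat k * 2 ^ Z.of_nat k - 2 * 2 ^ Z.of_nat k + 2.
Proof.
  induction k as [|k IH]; [reflexivity|].
  cbn [indices]. rewrite zsum_app, !zsum_map.
  rewrite (zsum_ext (fun m => Z.of_nat (length (forks (S k) (2 * m)))) (fun m => Z.of_nat (length (forks k m)))).
  2:{ intros m _. replace (2 * m) with (2 * m + 0) by lia. rewrite forks_double by lia.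
      simpl. now rewrite app_nil_r, length_map. }
  rewrite (zsum_ext (fun m => Z.of_nat (length (forks (S k) (2 * m + 1))))
     (fun m => Z.of_nat (length (forks k m)) + if m + 1 <? 2 ^ Z.of_nat k then 1 else 0)).
  2:{ intros m _. rewrite forks_double, length_app, length_map, pow2_S by lia. change (1 =? 1) with true. cbn [andb].
      destruct (Z.ltb_spec (2 * m + 1 + 1) (2 * 2 ^ Z.of_nat k)), (Z.ltb_spec (m + 1) (2 ^ Z.of_nat k)); cbn [length]; lia. }
  rewrite zsum_add, count_not_last, pow2_S. nia.
Qed.

(** * Funnel alternations of the tower *)

Lemma forallb_false_witness {A : Type} (f : A -> bool) l :
  forallb f l = false -> exists x, In x l /\ f x = false.
Proof.
  induction l as [|x l IH]; simpl; [discriminate|].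
  intros H. apply andb_false_iff in H as [H|H]; [exists x; auto|].
  destruct (IH H) as (y & Hy & E). exists y. auto.
Qed.

Definition opposite (x : Z) (u v : point) : Prop :=
  fst u < x < fst v \/ fst v < x < fst u.

(** A discrete intermediate value argument: a point [r] between [u] and [v] in height is opposite to
    one of them, and that pair is closer in height. It yields alternations without a full
    description of the funnel. *)
Lemma exists_alternation (F : list point) x u v :
  (forall q, In q F -> fst q <> x) ->
  In u F -> In v F -> snd u < snd v -> opposite x u v ->
  exists u' v', In u' F /\ In v' F /\ consec F u' v' = true /\ opposite x u' v' /\
                snd u <= snd u' /\ snd u' < snd v' /\ snd v' <= snd v.
Proof.
  intros HF. remember (Z.to_nat (snd v - snd u)) as n eqn:Hn. revert u v Hn.
  induction n as [n IH] using lt_wf_ind. intros u v Hn Hu Hv Hlt Hop.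
  destruct (consec F u v) eqn:Hc.
  - exists u, v. repeat split; auto; lia.
  - unfold consec in Hc. apply andb_false_iff in Hc as [Hc|Hc].
    { apply Z.ltb_ge in Hc. lia. }
    apply forallb_false_witness in Hc as (r & Hr & Hc).
    apply negb_false_iff, andb_true_iff in Hc as [H1 H2]. apply Z.ltb_lt in H1, H2.
    pose proof (HF r Hr) as Hrx.
    assert (opposite x u r \/ opposite x r v) as [H|H] by (unfold opposite in *; lia).
    + destruct (IH (Z.to_nat (snd r - snd u)) ltac:(lia) u r eq_refl Hu Hr H1 H)
        as (u' & v' & ? & ? & ? & ? & ? & ? & ?). exists u', v'. repeat split; auto; lia.
    + destruct (IH (Z.to_nat (snd v - snd r)) ltac:(lia) r v eq_refl Hr Hv H2 H)
        as (u' & v' & ? & ? & ? & ? & ? & ? & ?). exists u', v'. repeat split; auto; lia.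
Qed.

(** The last summand of the abscissa makes the scale its residue modulo [K] and keeps abscissae
    distinct across copies. *)
Definition tower_point (k : nat) (ti : Z * Z) : point :=
  let K := 2 ^ Z.of_nat k in
  (K * fst ti + K * 2 ^ snd ti + snd ti, K * fst ti + bit_reversal k (snd ti)).

(* Stacked copies, each shifted by one column, of a bit-reversal permutation with
   exponentially spaced columns. *)
Definition bit_reversal_tower (k : nat) : list point :=
  map (tower_point k) (list_prod (zint (-1) (2 ^ 2 ^ Z.of_nat k - 1)) (indices k)).

Lemma in_tower k p :
  In p (bit_reversal_tower k) <->
  exists t i, p = tower_point k (t, i) /\ 0 <= t < 2 ^ 2 ^ Z.of_nat k /\ 0 <= i < 2 ^ Z.of_nat k.
Proof.
  unfold bit_reversal_tower. rewrite in_map_iff. split.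
  - intros ([t i] & <- & H). apply in_prod_iff in H as [Ht Hi].
    apply in_zint in Ht. apply in_indices in Hi. exists t, i. repeat split; lia.
  - intros (t & i & -> & Ht & Hi). exists (t, i). split; [reflexivity|].
    apply in_prod_iff. rewrite in_zint, in_indices. lia.
Qed.

Lemma tower_point_coords k t i :
  0 <= i < 2 ^ Z.of_nat k ->
  time (2 ^ Z.of_nat k) (tower_point k (t, i)) = t /\ scale (2 ^ Z.of_nat k) (tower_point k (t, i)) = i.
Proof.
  intros Hi. pose proof (bit_reversal_range k i). unfold time, scale, tower_point. cbn [fst snd]. split.
  - symmetry. apply (Z.div_unique _ _ _ (bit_reversal k i)); lia.
  - symmetry. apply (Z.mod_unique _ _ (t + 2 ^ i)); lia.
Qed.

Lemma tower_point_snd_inj k t i t' i' :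
  0 <= i < 2 ^ Z.of_nat k -> 0 <= i' < 2 ^ Z.of_nat k ->
  snd (tower_point k (t, i)) = snd (tower_point k (t', i')) -> t = t' /\ i = i'.
Proof.
  intros Hi Hi' E. cbn [tower_point fst snd] in E.
  pose proof (bit_reversal_range k i). pose proof (bit_reversal_range k i').
  assert (t = t') by nia. split; auto. apply (bit_reversal_inj k); auto. subst. lia.
Qed.

Lemma tower_point_fst_inj k t i t' i' :
  0 <= i < 2 ^ Z.of_nat k -> 0 <= i' < 2 ^ Z.of_nat k ->
  fst (tower_point k (t, i)) = fst (tower_point k (t', i')) -> t = t' /\ i = i'.
Proof.
  intros Hi Hi' E.
  destruct (tower_point_coords k t i Hi) as [_ Hs], (tower_point_coords k t' i' Hi') as [_ Hs'].
  assert (i = i') by (rewrite <- Hs, <- Hs'; unfold scale; now rewrite E).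
  subst i'. cbn [tower_point fst snd] in E. split; auto. nia.
Qed.

Lemma NoDup_bit_reversal_tower k : NoDup (bit_reversal_tower k).
Proof.
  apply NoDup_map_NoDup_ForallPairs; [|apply NoDup_list_prod; [apply NoDup_zint|apply NoDup_indices]].
  intros [t i] [t' i'] H H' E. apply in_prod_iff in H as [_ H], H' as [_ H'].
  apply in_indices in H, H'.
  destruct (tower_point_snd_inj k t i t' i'); subst; auto. now rewrite E.
Qed.

Lemma tower_bit_reversal_tower k : tower (2 ^ Z.of_nat k) (bit_reversal_tower k).
Proof.
  split; [apply NoDup_bit_reversal_tower|]. split; [|split].
  - intros p Hp. apply in_tower in Hp as (t & i & -> & _ & Hi).
    destruct (tower_point_coords k t i Hi) as [-> ->]. reflexivity.
  - intros p q Hp Hq E. apply in_tower in Hp as (t & i & -> & _ & Hi).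
    apply in_tower in Hq as (t' & i' & -> & _ & Hi').
    now destruct (tower_point_fst_inj k t i t' i' Hi Hi' E) as [-> ->].
  - intros p q Hp Hq E. apply in_tower in Hp as (t & i & -> & _ & Hi).
    apply in_tower in Hq as (t' & i' & -> & _ & Hi').
    now destruct (tower_point_snd_inj k t i t' i' Hi Hi' E) as [-> ->].
Qed.

Lemma is_perm_bit_reversal_tower k : is_perm (bit_reversal_tower k).
Proof.
  destruct (tower_bit_reversal_tower k) as (Hnd & _ & Hf & Hs). split; [exact Hnd|].
  intros p q Hp Hq Hne. split; intros E; apply Hne; auto.
Qed.

Lemma column_mono k t i j :
  0 <= i < j -> fst (tower_point k (t, i)) < fst (tower_point k (t, j)).
Proof.
  intros H. cbn [tower_point fst snd]. pose proof (pow2_double i j H).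
  pose proof (pow2_pos i ltac:(lia)). pose proof (pow2_pos (Z.of_nat k) ltac:(lia)). nia.
Qed.

Lemma column_mono_inv k t i j :
  0 <= i -> 0 <= j -> fst (tower_point k (t, i)) <= fst (tower_point k (t, j)) -> i <= j.
Proof.
  intros Hi Hj H. destruct (Z_le_gt_dec i j); auto.
  pose proof (column_mono k t j i ltac:(lia)). lia.
Qed.

(** The rectangle stays within the band of copy [t], and columns increase with the index there, so
    only the indices between [a] and [i] could obstruct it. *)
Lemma in_funnel_tower k t i a :
  0 <= t < 2 ^ 2 ^ Z.of_nat k -> 0 <= i < 2 ^ Z.of_nat k -> 0 <= a < 2 ^ Z.of_nat k ->
  bit_reversal k a < bit_reversal k i ->
  (forall r, Z.min a i < r < Z.max a i -> bit_reversal k r <= bit_reversal k i ->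
             bit_reversal k r < bit_reversal k a) ->
  In (tower_point k (t, a)) (funnel (bit_reversal_tower k) (tower_point k (t, i))).
Proof.
  intros Ht Hi Ha Hlt Hempty. unfold funnel. apply filter_In. split.
  { apply in_tower. exists t, a. auto. }
  apply andb_true_iff. split.
  { apply Z.ltb_lt. cbn [tower_point fst snd]. lia. }
  apply forallb_forall. intros r Hr. apply in_tower in Hr as (t' & j & -> & _ & Hj).
  destruct (in_box (tower_point k (t, i)) (tower_point k (t, a)) (tower_point k (t', j))) eqn:Hb;
    [|now rewrite orb_true_r].
  unfold in_box in Hb. apply andb_true_iff in Hb as [Hb H4]. apply andb_true_iff in Hb as [Hb H3].
  apply andb_true_iff in Hb as [H1 H2]. apply Z.leb_le in H1, H2, H3, H4.
  pose proof (bit_reversal_range k i). pose proof (bit_reversal_range k a).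
  pose proof (bit_reversal_range k j).
  assert (t' = t) by (cbn [tower_point snd fst] in H3, H4; nia). subst t'.
  assert (Hrefl : forall p, pt_eqb p p = true) by (intros p; unfold pt_eqb; now rewrite !Z.eqb_refl).
  destruct (Z.eq_dec j i) as [->|Hji]; [now rewrite Hrefl|].
  destruct (Z.eq_dec j a) as [->|Hja]; [now rewrite Hrefl, orb_true_r|].
  exfalso.
  assert (Z.min a i <= j).
  { destruct (Z.le_ge_cases a i).
    - pose proof (column_mono_inv k t a j). destruct (Z.eq_dec a i); [subst; lia|].
      pose proof (column_mono k t a i). lia.
    - pose proof (column_mono_inv k t i j). destruct (Z.eq_dec a i); [subst; lia|].
      pose proof (column_mono k t i a). lia. }
  assert (j <= Z.max a i).
  { destruct (Z.le_ge_cases a i).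
    - pose proof (column_mono_inv k t j i). destruct (Z.eq_dec a i); [subst; lia|].
      pose proof (column_mono k t a i). lia.
    - pose proof (column_mono_inv k t j a). destruct (Z.eq_dec a i); [subst; lia|].
      pose proof (column_mono k t i a). lia. }
  cbn [tower_point snd fst] in H3, H4.
  specialize (Hempty j ltac:(lia) ltac:(lia)). lia.
Qed.

(** The two ends of a fork are funnel points on opposite sides, so some alternation lies in the
    height range of the fork. These ranges are disjoint, so different forks yield different
    alternations. *)
Lemma alt_ge_forks k t i :
  0 <= t < 2 ^ 2 ^ Z.of_nat k -> 0 <= i < 2 ^ Z.of_nat k ->
  (length (forks k i) <= alt (bit_reversal_tower k) (tower_point k (t, i)))%nat.
Proof.
  intros Ht Hi. set (X := bit_reversal_tower k). set (p := tower_point k (t, i)).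
  unfold alt, countb. set (F := funnel X p).
  set (y := fun a => snd (tower_point k (t, a))).
  apply (rel_inj_length (fun e uv =>
    Z.min (y (fst e)) (y (snd e)) <= snd (fst uv) /\ snd (fst uv) < snd (snd uv) /\
    snd (snd uv) <= Z.max (y (fst e)) (y (snd e)))).
  - now apply NoDup_forks.
  - intros [a b] Hab. destruct (forks_spec k i a b Hi Hab) as (H1 & H2 & H3 & H4 & H5 & H6).
    assert (Ha : In (tower_point k (t, a)) F).
    { apply in_funnel_tower; auto; [lia|]. intros r Hr Hle. specialize (H6 r ltac:(lia) ltac:(lia) Hle). lia. }
    assert (Hb : In (tower_point k (t, b)) F).
    { apply in_funnel_tower; auto; [lia|]. intros r Hr Hle. specialize (H6 r ltac:(lia) ltac:(lia) Hle). lia. }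
    assert (HF : forall q, In q F -> fst q <> fst p).
    { intros q Hq E. apply filter_In in Hq as [Hq Hlt]. apply andb_true_iff in Hlt as [Hlt _].
      apply Z.ltb_lt in Hlt. destruct (tower_bit_reversal_tower k) as (_ & _ & Hf & _).
      assert (Eq : q = p); [|rewrite Eq in Hlt; lia]. apply Hf; auto. apply in_tower. exists t, i. auto. }
    pose proof (column_mono k t a i ltac:(lia)). pose proof (column_mono k t i b ltac:(lia)).
    fold p in H, H0.
    assert (Hy : forall c d, In (tower_point k (t, c)) F -> In (tower_point k (t, d)) F ->
       opposite (fst p) (tower_point k (t, c)) (tower_point k (t, d)) -> y c < y d ->
       exists uv, In uv (filter (fun ab => consec F (fst ab) (snd ab) &&
          (((fst (fst ab) <? fst p) && (fst p <? fst (snd ab))) ||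
           ((fst (snd ab) <? fst p) && (fst p <? fst (fst ab))))) (list_prod F F)) /\
          y c <= snd (fst uv) /\ snd (fst uv) < snd (snd uv) /\ snd (snd uv) <= y d).
    { intros c d Hc Hd Hop Hlt.
      destruct (exists_alternation F (fst p) _ _ HF Hc Hd Hlt Hop)
        as (u & v & Hu & Hv & Hcons & Hop' & L1 & L2 & L3).
      exists (u, v). cbn [fst snd]. split; [|auto].
      apply filter_In. split; [now apply in_prod|]. cbn [fst snd]. rewrite Hcons, andb_true_l.
      apply orb_true_iff. rewrite !andb_true_iff, !Z.ltb_lt. unfold opposite in Hop'. lia. }
    assert (y a <> y b) by (unfold y; cbn [tower_point fst snd]; lia).
    destruct (Z.lt_ge_cases (y a) (y b)) as [L|L].
    + destruct (Hy a b Ha Hb) as (uv & Huv & ?); [unfold opposite; lia|exact L|].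
      exists uv. split; [exact Huv|].
      change (Z.min (y a) (y b) <= snd (fst uv) /\ snd (fst uv) < snd (snd uv) <= Z.max (y a) (y b)). lia.
    + destruct (Hy b a Hb Ha) as (uv & Huv & ?); [unfold opposite; lia|lia|].
      exists uv. split; [exact Huv|].
      change (Z.min (y a) (y b) <= snd (fst uv) /\ snd (fst uv) < snd (snd uv) <= Z.max (y a) (y b)). lia.
  - intros e e' uv He He' Q Q'.
    destruct (forks_below k i e e' Hi He He') as [E|[E|E]]; [exact E|exfalso..];
      unfold below, y in *; cbn [tower_point fst snd] in *; lia.
Qed.

(** * Both bounds in terms of the size of the tower *)

Lemma length_bit_reversal_tower k :
  Z.of_nat (length (bit_reversal_tower k)) = 2 ^ 2 ^ Z.of_nat k * 2 ^ Z.of_nat k.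
Proof.
  unfold bit_reversal_tower. rewrite length_map, length_prod, Nat2Z.inj_mul, length_indices, length_zint.
  pose proof (pow2_pos (2 ^ Z.of_nat k)). pose proof (pow2_pos (Z.of_nat k)). nia.
Qed.

(** With [K = 2 ^ k], a copy has at least [k * K / 2 - K + 1] alternations, and the summand [|X|]
    makes up for the lost [K]. *)
Lemma WB2_bit_reversal_tower k :
  Z.of_nat k * Z.of_nat (length (bit_reversal_tower k)) <= 2 * Z.of_nat (WB2 (bit_reversal_tower k)).
Proof.
  unfold WB2. rewrite Nat2Z.inj_add.
  assert (H : Z.of_nat (fold_right Nat.add O (map (alt (bit_reversal_tower k)) (bit_reversal_tower k)))
     >= 2 ^ 2 ^ Z.of_nat k * zsum (fun i => Z.of_nat (length (forks k i))) (indices k)).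
  { set (f := alt (bit_reversal_tower k)).
    assert (E : forall l, Z.of_nat (fold_right Nat.add O (map f l)) = zsum (fun p => Z.of_nat (f p)) l).
    { unfold zsum. induction l; simpl; lia. }
    rewrite E. unfold bit_reversal_tower. rewrite zsum_map.
    pose proof (pow2_pos (2 ^ Z.of_nat k) ltac:(lia)).
    replace (2 ^ 2 ^ Z.of_nat k) with (Z.of_nat (length (zint (-1) (2 ^ 2 ^ Z.of_nat k - 1)))) at 2
      by (rewrite length_zint; lia).
    rewrite <- (zsum_list_prod (fun i => Z.of_nat (length (forks k i)))).
    apply Z.le_ge, zsum_le. intros [t i] Hti. apply in_prod_iff in Hti as [Ht Hi].
    apply in_zint in Ht. apply in_indices in Hi. cbn [snd].
    apply Nat2Z.inj_le, alt_ge_forks; lia. }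
  rewrite length_bit_reversal_tower. pose proof (sum_forks k).
  pose proof (pow2_pos (2 ^ Z.of_nat k) ltac:(lia)). nia.
Qed.

Lemma WB_bit_reversal_tower k :
  Z.of_nat (WB (bit_reversal_tower k)) <= 246 * Z.of_nat (length (bit_reversal_tower k)).
Proof.
  rewrite length_bit_reversal_tower. set (K := 2 ^ Z.of_nat k).
  assert (HK : 0 < K) by (apply pow2_pos; lia).
  assert (HT : 0 < 2 ^ K) by (apply pow2_pos; lia).
  (* The strip [(0, 2 * K * 2 ^ K]] is twice as wide as the number of points, hence
     [246 = 2 * 123]. *)
  assert (H : Z.of_nat (WB (bit_reversal_tower k)) <= 123 * (2 * K * 2 ^ K - 0)); [|lia].
  apply (WB_tower_le K); auto; try nia.
  - intros E. pose proof (length_bit_reversal_tower k) as L. rewrite E in L. fold K in L.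
    cbn [length] in L. nia.
  - apply tower_bit_reversal_tower.
  - intros p Hp. apply in_tower in Hp as (t & i & -> & Ht & Hi). cbn [tower_point fst snd].
    fold K in Ht, Hi |- *.
    pose proof (pow2_pos i ltac:(lia)).
    assert (2 * 2 ^ i <= 2 ^ K) by (apply pow2_double; lia).
    assert (t + 2 ^ i + 1 <= 2 * 2 ^ K) by lia. nia.
Qed.

(** * Iterated logarithms of the size *)

Open Scope R_scope.

Lemma ln_ge_of_exp_le x y : exp x <= y -> x <= ln y.
Proof.
  intros H. rewrite <- (ln_exp x). pose proof (exp_pos x).
  destruct H as [H|<-]; [left; now apply ln_increasing|apply Rle_refl].
Qed.

Lemma ln2_bounds : / 2 <= ln 2 <= 1.
Proof.
  split; [pose proof ln_lt_2; lra|].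
  pose proof (exp_ineq1 1 ltac:(lra)). rewrite <- (ln_exp 1). left. apply ln_increasing; lra.
Qed.

(** [ln n] lies between [2 ^ k / 2] and [2 * 2 ^ k]. Since the first bound is linear in [n], it is
    enough that the triple logarithm is at least 1. *)
Lemma ln_tower_size k n :
  (9 <= k)%nat -> Z.of_nat n = (2 ^ 2 ^ Z.of_nat k * 2 ^ Z.of_nat k)%Z ->
  ln (ln (INR n)) <= 2 * INR k /\ 1 <= ln (ln (ln (INR n))).
Proof.
  intros Hk Hn.
  pose proof ln2_bounds as L2.
  assert (Hpow : forall m : nat, IZR (2 ^ Z.of_nat m) = 2 ^ m) by
    (intros m; now rewrite <- pow_IZR).
  assert (En : INR n = 2 ^ (2 ^ k) * 2 ^ k).
  { rewrite INR_IZR_INZ, Hn, mult_IZR, Hpow. f_equal.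
    replace (2 ^ Z.of_nat k)%Z with (Z.of_nat (2 ^ k)) by (now rewrite Nat2Z.inj_pow).
    apply Hpow. }
  assert (Eln : ln (INR n) = (INR (2 ^ k) + INR k) * ln 2).
  { rewrite En, ln_mult, !ln_pow by (try apply pow_lt; lra). ring. }
  assert (Hk9 : 9 <= INR k) by (replace 9 with (INR 9) by (simpl; lra); now apply le_INR).
  assert (Ek : INR (2 ^ k) = 2 ^ k) by (now rewrite pow_INR).
  assert (Hkk : INR k <= 2 ^ k).
  { rewrite <- Ek. apply le_INR. pose proof (Nat.pow_gt_lin_r 2 k). lia. }
  assert (Hlo : 2 ^ k / 2 <= ln (INR n)) by (rewrite Eln, Ek; nra).
  assert (Hhi : ln (INR n) <= 2 * 2 ^ k) by (rewrite Eln, Ek; nra).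
  assert (Hp : 0 < 2 ^ k) by (apply pow_lt; lra).
  split.
  - apply Rle_trans with (ln (2 * 2 ^ k)).
    + destruct Hhi as [H|H]; [left; apply ln_increasing; lra|rewrite H; apply Rle_refl].
    + rewrite ln_mult, ln_pow by lra. nra.
  (* The source of [9 <= k]: [(k - 1) * ln 2 >= 8 / 2], which exceeds [exp 1]. *)
  - assert (H4 : 4 <= ln (ln (INR n))).
    { apply Rle_trans with (ln (2 ^ k / 2)).
      - unfold Rdiv. rewrite ln_mult, ln_Rinv, ln_pow by lra. nra.
      - destruct Hlo as [H|H]; [left; apply ln_increasing; lra|rewrite H; apply Rle_refl]. }
    apply ln_ge_of_exp_le. pose proof exp_le_3. lra.
Qed.

Theorem theorem4p16 :
  exists c1 c2 : R, 0 < c1 /\ 0 < c2 /\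
    forall n' : nat, exists (n : nat) (X : list point),
      (n' <= n)%nat /\ length X = n /\ is_perm X /\
      c1 * INR n * ln (ln (INR n)) <= INR (WB2 X) /\
      INR (WB X) <= c2 * INR n * ln (ln (ln (INR n))).
Proof.
  (* The factor [/ 4] combines [WB2 X >= k * n / 2] with [ln (ln n) <= 2 * k]. *)
  exists (/ 4), 246. split; [lra|]. split; [lra|]. intros n'.
  (* The size exceeds [k], hence [n']; the 9 serves the logarithmic estimates. *)
  set (k := (n' + 9)%nat). set (X := bit_reversal_tower k).
  exists (length X), X.
  pose proof (length_bit_reversal_tower k) as Hlen. fold X in Hlen.
  destruct (ln_tower_size k (length X) ltac:(lia) Hlen) as [Hll Hlll].
  pose proof (WB2_bit_reversal_tower k) as H2. pose proof (WB_bit_reversal_tower k) as H1.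
  fold X in H1, H2. apply IZR_le in H1, H2.
  rewrite mult_IZR, <- !INR_IZR_INZ in H1. rewrite (mult_IZR (Z.of_nat k)), (mult_IZR 2), <- !INR_IZR_INZ in H2.
  pose proof (pos_INR (length X)) as Hpos.
  split; [|split; [reflexivity|split; [apply is_perm_bit_reversal_tower|split]]].
  - apply Nat2Z.inj_le. rewrite Hlen.
    pose proof (pow2_pos (2 ^ Z.of_nat k) ltac:(lia)).
    pose proof (Z.pow_gt_lin_r 2 (Z.of_nat k) ltac:(lia) ltac:(lia)). nia.
  - apply Rle_trans with (/ 4 * INR (length X) * (2 * INR k)); [|lra].
    apply Rmult_le_compat_l; lra.
  - apply Rle_trans with (246 * INR (length X) * 1); [lra|].
    apply Rmult_le_compat_l; lra.
Qed.
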